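(* Let $R$ be a left Zacharias domain which is a (commutative) principal ideal domain, let $\mathsf R$ be a multivariate Ore extension of $R$ in which each $\alpha_i$ is an automorphism of $R$, let $F=\{g_1,\dots,g_u\}\subset\mathsf R^m\setminus\{0\}$ and let $\mathsf M=\mathbb I_L(F)$ be the left module generated by $F$. Let $\mathfrak{GM}$ be a useful S-pair set for $F$. Then $F$ is a left Gröbner basis of $\mathsf M$ if and only if each S-polynomial $B(i,j)$ with $\{i,j\}\in\mathfrak{GM}$ has a left Gröbner representation in terms of $F$.
   Context: **Ore extensions.** A multivariate Ore extension $\mathsf R=R[Y_1;\alpha_1,\delta_1]\cdots[Y_n;\alpha_n,\delta_n]$ of a domain $R$ is an iterated Ore extension ($Y_i\star r=\alpha_i(r)Y_i+\delta_i(r)$, $\alpha_i$ an injective ring endomorphism mapping $R$ to $R$, $\delta_i$ an $\alpha_i$-derivation mapping $R$ to $R$) such that $\alpha_j\delta_i=\delta_i\alpha_j$ for $i\ne j$, $\alpha_i\alpha_j=\alpha_j\alpha_i$, $\delta_i\delta_j=\delta_j\delta_i$, and $\alpha_j(Y_i)=Y_i$, $\delta_j(Y_i)=0$ for $i<j$. Its multiplication is $\star$. It is a free left $R$-module on the set of terms $\mathcal T=\{Y_1^{a_1}\cdots Y_n^{a_n}\}$, a commutative monoid. For $\tau=Y_1^{a_1}\cdots Y_n^{a_n}$ put $\alpha_\tau=\alpha_1^{a_1}\cdots\alpha_n^{a_n}:R\to R$. The associated graded Ore extension $\mathsf S$ is the same left $R$-module with multiplication $\ast$ determined by $(a\tau)\ast(b\omega)=a\,\alpha_\tau(b)\,\tau\omega$.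 **Orderings.** $\mathsf R^m$ has canonical basis $\mathbf e_1,\dots,\mathbf e_m$ and terms $\mathcal T^{(m)}=\{t\mathbf e_i\}$. Fix a term ordering $\prec$ on $\mathcal T$ and a compatible term ordering $<$ on $\mathcal T^{(m)}$: a well-ordering with $\omega_1\prec\omega_2\Rightarrow\omega_1t<\omega_2t$ and $t_1<t_2\Rightarrow\omega t_1<\omega t_2$. $\mathbf T(f)$, $\mathrm{lc}(f)$, $\mathbf M(f)=\mathrm{lc}(f)\mathbf T(f)$ are maximal term, leading coefficient and maximal monomial. **Gröbner notions.** $F$ is a left (weak) Gröbner basis of $\mathsf M=\mathbb I_L(F)$ if for every $f\in\mathsf M\setminus\{0\}$, $\mathbf M(f)=\sum_ia_i\lambda_i\ast\mathbf M(g_{j_i})$ with $a_i\in R\setminus\{0\}$, $\lambda_i\in\mathcal T$, $\lambda_i\mathbf T(g_{j_i})=\mathbf T(f)$. A left Gröbner representation of $f$ is $f=\sum_il_i\star g_i$ with $l_i\in\mathsf R$ and $\mathbf T(l_i)\mathbf T(g_i)\le\mathbf T(f)$ whenever $l_i\ne0$ (zero has the trivial representation). **S-pairs.** Write $\mathbf M(g_i)=c_i\tau_i\mathbf e_{l_i}$. For $i<j$ with $\mathbf e_{l_i}=\mathbf e_{l_j}$ put $\tau(i,j)=\mathrm{lcm}(\tau_i,\tau_j)$, $a_{ij}=\alpha_{\tau(i,j)/\tau_i}(c_i)$, $a_{ji}=\alpha_{\tau(i,j)/\tau_j}(c_j)$, $c(i,j)=\mathrm{lcm}(a_{ij},a_{ji})$,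 $b(i,j)=\frac{c(i,j)}{a_{ji}}\frac{\tau(i,j)}{\tau_j}e_j-\frac{c(i,j)}{a_{ij}}\frac{\tau(i,j)}{\tau_i}e_i\in\mathsf S^u$ and $B(i,j)=\frac{c(i,j)}{a_{ji}}\frac{\tau(i,j)}{\tau_j}\star g_j-\frac{c(i,j)}{a_{ij}}\frac{\tau(i,j)}{\tau_i}\star g_i$. Let $\mathfrak s_L:\mathsf S^u\to\mathsf S^m$, $\sum h_ie_i\mapsto\sum h_i\ast\mathbf M(g_i)$. A left Gebauer–Möller set for $F$ is a set of generators of the left $\mathsf S$-module $\ker(\mathfrak s_L)$, each homogeneous (i.e. of the form $\sum a_i\lambda_ie_i$, $a_i\in R$, $\lambda_i\in\mathcal T$, with $\lambda_i\mathbf T(g_i)$ the same term for all $i$ with $a_i\ne0$). A useful S-pair set for $F$ is a subset $\mathfrak{GM}\subset\{\{i,j\}:1\le i<j\le u,\ \mathbf e_{l_i}=\mathbf e_{l_j}\}$ such that $\{b(i,j):\{i,j\}\in\mathfrak{GM}\}$ is a left Gebauer–Möller set for $F$. **Zacharias ring.** A ring $R$ with identity is a left Zacharias ring if it is noetherian, there is an algorithm deciding membership of $c\in R^m$ in the left module generated by a finite $\{c_1,\dots,c_t\}\subset R^m\setminus\{0\}$ and producing $d_i$ with $c=\sum d_ic_i$ when it holds, and there is an algorithm computing a finite generating set of the left syzygy module of $c_1,\dots,c_t$. *)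

(* Defs.v *)
From mathcomp Require Import all_boot all_order all_algebra.
From mathcomp Require Export mpoly.
From Stdlib Require Import ClassicalEpsilon.

Set Implicit Arguments.
Unset Strict Implicit.
Unset Printing Implicit Defensive.

Import GRing.Theory.
Local Open Scope ring_scope.

Definition left_ideal (R : nzRingType) (I : R -> Prop) : Prop :=
  [/\ I 0, forall x y, I x -> I y -> I (x + y) & forall a x, I x -> I (a * x)].

Definition principal_ideal_ring (R : comNzRingType) : Prop :=
  forall I : R -> Prop, left_ideal I ->
    exists a : R, forall x, I x <-> exists b, x = b * a.

Definition left_noetherian (R : nzRingType) : Prop :=
  forall I : R -> Prop, left_ideal I ->
    exists (k : nat) (g : 'I_k -> R),
      forall x, I x <-> exists d : 'I_k -> R, x = \sum_i d i * g i.

(* The two algorithms are functions with values in [Type], as usual in type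
   theory; a value of this type is the ring equipped with them. *)
Record left_zacharias (R : nzRingType) : Type := LeftZacharias {
  zach_noetherian : left_noetherian R /\ left_noetherian R^c;
  zach_membership : forall (m t : nat) (c : 'I_t -> 'rV[R]_m),
    (forall i, c i != 0) -> forall v : 'rV[R]_m,
    {d : 'I_t -> R | v = \sum_i d i *: c i}
    + (~ exists d : 'I_t -> R, v = \sum_i d i *: c i);
  zach_syzygy : forall (m t : nat) (c : 'I_t -> 'rV[R]_m),
    (forall i, c i != 0) ->
    {k : nat & {s : 'I_k -> 'I_t -> R |
      (forall l, \sum_i s l i *: c i = 0) /\
      (forall d : 'I_t -> R, \sum_i d i *: c i = 0 ->
         exists e : 'I_k -> R, forall i, d i = \sum_l e l * s l i)}}
}.

Definition divides (R : idomainType) (x y : R) : Prop := exists z, y = z * x.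

Definition is_lcm (R : idomainType) (a b c : R) : Prop :=
  [/\ divides a c, divides b c
    & forall d, divides a d -> divides b d -> divides c d].

(* The quotient of [x] by [y] when [y != 0] divides [x]; arbitrary otherwise. *)
Definition exact_quot (R : idomainType) (x y : R) : R :=
  epsilon (inhabits 0) (fun q => q * y = x).

(* All Ore extensions below live on the additive group [{mpoly R[n]}], the free
   left [R]-module on the terms ['X_[t]], [t : 'X_{1..n}].  Its commutative
   product is never used: the product is an explicit operation [mul]. *)
Section OreExtension.
Variables (R : idomainType) (n : nat).
Notation P := {mpoly R[n]}.

Definition mulpow (mul : P -> P -> P) (y : P) (k : nat) : P :=
  iter k (mul y) 1.

(* [B] is the Ore extension [A[y; sigma, delta]]; [sigma] and [delta] are only
   meaningful on [A]. *)
Record is_ore_extension (mul : P -> P -> P) (A B : P -> Prop) (y : P)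
    (sigma delta : P -> P) : Prop := IsOreExtension {
  ore_sigma_stable : forall f, A f -> A (sigma f);
  ore_sigma1 : sigma 1 = 1;
  ore_sigmaD : forall f g, A f -> A g -> sigma (f + g) = sigma f + sigma g;
  ore_sigmaM :
    forall f g, A f -> A g -> sigma (mul f g) = mul (sigma f) (sigma g);
  ore_sigma_inj : forall f g, A f -> A g -> sigma f = sigma g -> f = g;
  ore_delta_stable : forall f, A f -> A (delta f);
  ore_deltaD : forall f g, A f -> A g -> delta (f + g) = delta f + delta g;
  ore_deltaM : forall f g, A f -> A g ->
    delta (mul f g) = mul (sigma f) (delta g) + mul (delta f) g;
  ore_mulC : forall f, A f -> mul y f = mul (sigma f) y + delta f;
  ore_span : forall f, B f <->
    exists (k : nat) (a : 'I_k -> P),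
      (forall i, A (a i)) /\ f = \sum_(i < k) mul (a i) (mulpow mul y i);
  ore_free : forall (k : nat) (a : 'I_k -> P), (forall i, A (a i)) ->
    \sum_(i < k) mul (a i) (mulpow mul y i) = 0 -> forall i, a i = 0
}.

(* The polynomials involving only the variables of index less than [k]. *)
Definition in_vars (k : nat) (f : P) : Prop :=
  forall (t : 'X_{1..n}) (i : 'I_n), t \in msupp f -> (k <= i)%N -> t i = 0%N.

(* [ore_Alpha j] and [ore_Delta j] act on the stage [in_vars j], to which the
   variable ['X_j] is then adjoined; [ore_alpha j] and [ore_delta j] are their
   restrictions to [R].  [ore_mulCl] and [ore_term] identify the underlying
   left [R]-module with the free one on the ordered products of the ['X_i]. *)
Record multivariate_ore : Type := MultivariateOre {
  ore_mul : P -> P -> P;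
  ore_Alpha : 'I_n -> P -> P;
  ore_Delta : 'I_n -> P -> P;
  ore_alpha : 'I_n -> R -> R;
  ore_delta : 'I_n -> R -> R;
  ore_mulA : associative ore_mul;
  ore_mul1 : left_id 1 ore_mul;
  ore_1mul : right_id 1 ore_mul;
  ore_mulDl : left_distributive ore_mul +%R;
  ore_mulDr : right_distributive ore_mul +%R;
  ore_mulCl : forall (c : R) (f : P), ore_mul c%:MP f = c *: f;
  ore_term : forall t : 'X_{1..n},
    \big[ore_mul/1]_(i < n) mulpow ore_mul 'X_i (t i) = 'X_[t];
  ore_iterated : forall j : 'I_n,
    is_ore_extension ore_mul (in_vars j) (in_vars j.+1) 'X_j
      (ore_Alpha j) (ore_Delta j);
  ore_AlphaC : forall j c, ore_Alpha j c%:MP = (ore_alpha j c)%:MP;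
  ore_DeltaC : forall j c, ore_Delta j c%:MP = (ore_delta j c)%:MP;
  ore_alpha_delta : forall i j c, i != j ->
    ore_alpha j (ore_delta i c) = ore_delta i (ore_alpha j c);
  ore_alpha_alpha : forall i j c,
    ore_alpha i (ore_alpha j c) = ore_alpha j (ore_alpha i c);
  ore_delta_delta : forall i j c,
    ore_delta i (ore_delta j c) = ore_delta j (ore_delta i c);
  ore_AlphaX : forall i j : 'I_n, (i < j)%N -> ore_Alpha j 'X_i = 'X_i;
  ore_DeltaX : forall i j : 'I_n, (i < j)%N -> ore_Delta j 'X_i = 0
}.

Definition alpha_term (O : multivariate_ore) (t : 'X_{1..n}) (c : R) : R :=
  foldr (fun i x => iter (t i) (ore_alpha O i) x) c (enum 'I_n).

Definition graded_mul (O : multivariate_ore) (f g : P) : P :=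
  \sum_(t <- msupp f) \sum_(w <- msupp g)
    (f@_t * alpha_term O t g@_w) *: 'X_[(t + w)%MM].

Definition lscale (mul : P -> P -> P) (k : nat) (h : P) (v : 'rV[P]_k) :
  'rV[P]_k := map_mx (mul h) v.

Definition left_span (mul : P -> P -> P) (k : nat) (B : 'rV[P]_k -> Prop)
    (v : 'rV[P]_k) : Prop :=
  exists (s : nat) (h : 'I_s -> P) (b : 'I_s -> 'rV[P]_k),
    (forall i, B (b i)) /\ v = \sum_i lscale mul (h i) (b i).

End OreExtension.

Definition well_order (T : eqType) (lt : rel T) : Prop :=
  [/\ irreflexive lt, transitive lt,
      forall x y, x != y -> lt x y || lt y x
    & well_founded (fun x y => lt x y)].

(* The pair [(t, i)] stands for the module term [t e_i]. *)
Definition mterm (n m : nat) : eqType := ('X_{1..n} * 'I_m)%type.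

Definition mterm_mul (n m : nat) (w : 'X_{1..n}) (t : mterm n m) :
  mterm n m := ((w + t.1)%MM, t.2).

Definition term_ordering (n : nat) (prec : rel 'X_{1..n}) : Prop :=
  well_order prec /\
  forall w t1 t2, prec t1 t2 -> prec (w + t1)%MM (w + t2)%MM.

Definition compatible_ordering (n m : nat) (prec : rel 'X_{1..n})
    (lt : rel (mterm n m)) : Prop :=
  [/\ well_order lt,
      forall w1 w2 t, prec w1 w2 -> lt (mterm_mul w1 t) (mterm_mul w2 t)
    & forall w t1 t2, lt t1 t2 -> lt (mterm_mul w t1) (mterm_mul w t2)].

Definition max_term (T : eqType) (lt : rel T) (s : seq T) : option T :=
  ohead [seq t <- s | all (fun t' => (t' == t) || lt t' t) s].

Section Leading.
Variables (R : idomainType) (n m : nat).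
Notation P := {mpoly R[n]}.
Variables (prec : rel 'X_{1..n}) (lt : rel (mterm n m)).

(* Leading terms are [None] exactly at 0 when the orderings are total. *)
Definition lead_term_ring (f : P) : option 'X_{1..n} :=
  max_term prec (msupp f).

Definition mod_supp (f : 'rV[P]_m) : seq (mterm n m) :=
  flatten [seq [seq (t, i) | t <- msupp (f 0 i)] | i <- enum 'I_m].

Definition lead_term (f : 'rV[P]_m) : option (mterm n m) :=
  max_term lt (mod_supp f).

Definition lead_coeff (f : 'rV[P]_m) : R :=
  if lead_term f is Some t then (f 0 t.2)@_(t.1) else 0.

Definition lead_mon (f : 'rV[P]_m) : 'rV[P]_m :=
  if lead_term f is Some t
  then \row_k ((lead_coeff f *: 'X_[t.1]) *+ (k == t.2)) else 0.

Definition oterm_mul (w : option 'X_{1..n}) (t : option (mterm n m)) :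
    option (mterm n m) :=
  if (w, t) is (Some w', Some t') then Some (mterm_mul w' t') else None.

Definition oterm_le (s t : option (mterm n m)) : bool :=
  if (s, t) is (Some s', Some t') then (s' == t') || lt s' t' else false.

End Leading.

Section Groebner.
Variables (R : idomainType) (n m u : nat) (O : multivariate_ore R n).
Notation P := {mpoly R[n]}.
Variables (prec : rel 'X_{1..n}) (lt : rel (mterm n m)).
Variable g : 'I_u -> 'rV[P]_m.

Definition left_module_gen : 'rV[P]_m -> Prop :=
  left_span (ore_mul O) (fun v => exists i, v = g i).

Definition is_left_groebner_basis : Prop :=
  forall f, left_module_gen f -> f != 0 ->
    exists (s : nat) (a : 'I_s -> R) (lam : 'I_s -> 'X_{1..n})
           (j : 'I_s -> 'I_u),
      [/\ forall i, a i != 0,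
          forall i, oterm_mul (Some (lam i)) (lead_term lt (g (j i)))
                    = lead_term lt f
        & lead_mon lt f
          = \sum_i lscale (graded_mul O) (a i *: 'X_[lam i])
                     (lead_mon lt (g (j i)))].

(* For [f = 0] the inequality never holds, leaving the trivial
   representation. *)
Definition has_left_groebner_repr (f : 'rV[P]_m) : Prop :=
  exists l : 'I_u -> P,
    f = \sum_i lscale (ore_mul O) (l i) (g i) /\
    forall i, l i != 0 ->
      oterm_le lt
        (oterm_mul (lead_term_ring prec (l i)) (lead_term lt (g i)))
        (lead_term lt f).

(* Below, [lead_mon lt (g i) = lead_coeff lt (g i) (tau i) e_(comp i)]. *)
Definition tau (i : 'I_u) : 'X_{1..n} :=
  if lead_term lt (g i) is Some t then t.1 else 0%MM.

Definition comp (i : 'I_u) : option 'I_m :=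
  if lead_term lt (g i) is Some t then Some t.2 else None.

Definition cofactor_term (i j : 'I_u) : 'X_{1..n} :=
  (mlcm (tau i) (tau j) - tau i)%MM.

Definition twisted_lc (i j : 'I_u) : R :=
  alpha_term O (cofactor_term i j) (lead_coeff lt (g i)).

Definition is_spair (i j : 'I_u) : bool :=
  (i < j)%N && (comp i == comp j).

(* [c i j] is a chosen least common multiple for each pair; lcms in [R] are
   only determined up to units. *)
Definition is_lcm_choice (c : 'I_u -> 'I_u -> R) : Prop :=
  forall i j, is_spair i j -> is_lcm (twisted_lc i j) (twisted_lc j i) (c i j).

Variable c : 'I_u -> 'I_u -> R.

Definition spair_left (i j : 'I_u) : P :=
  exact_quot (c i j) (twisted_lc i j) *: 'X_[cofactor_term i j].

Definition spair_right (i j : 'I_u) : P :=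
  exact_quot (c i j) (twisted_lc j i) *: 'X_[cofactor_term j i].

Definition b_syz (i j : 'I_u) : 'rV[P]_u :=
  \row_k (spair_right i j *+ (k == j) - spair_left i j *+ (k == i)).

Definition S_poly (i j : 'I_u) : 'rV[P]_m :=
  lscale (ore_mul O) (spair_right i j) (g j)
  - lscale (ore_mul O) (spair_left i j) (g i).

Definition s_L (h : 'rV[P]_u) : 'rV[P]_m :=
  \sum_i lscale (graded_mul O) (h 0 i) (lead_mon lt (g i)).

Definition homogeneous (h : 'rV[P]_u) : Prop :=
  exists (a : 'I_u -> R) (lam : 'I_u -> 'X_{1..n}),
    (forall i, h 0 i = a i *: 'X_[lam i]) /\
    forall i j, a i != 0 -> a j != 0 ->
      oterm_mul (Some (lam i)) (lead_term lt (g i))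
      = oterm_mul (Some (lam j)) (lead_term lt (g j)).

Definition is_gebauer_moeller_set (B : 'rV[P]_u -> Prop) : Prop :=
  (forall h, B h -> homogeneous h) /\
  forall h, s_L h = 0 <-> left_span (graded_mul O) B h.

(* The unordered pair {i, j} with [i < j] is encoded as [(i, j)]. *)
Definition is_useful_spair_set (GM : {set 'I_u * 'I_u}) : Prop :=
  (forall p, p \in GM -> is_spair p.1 p.2) /\
  is_gebauer_moeller_set (fun h => exists2 p, p \in GM & h = b_syz p.1 p.2).

End Groebner.

(* Main.v *)
(** Under [*] and under the graded product, the products of two monomials [a t]
    and [b w] have the same leading part [a alpha_t(b) tw] and differ by smaller
    terms.  Hence division by a Groebner basis terminates and gives Groebner
    representations.  Conversely, take [f = sum l_i * g_i] whose largest
    term [T = max T(l_i) T(g_i)] is minimal.  If the parts of degree [T]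
    cancel, they form a syzygy of the leading monomials, hence a combination
    of shifted [b(i,j)] of degree [T]; replacing the [b(i,j)] by the
    representations of the [B(i,j)], whose leading terms are smaller than the
    degrees of the [b(i,j)], contradicts the minimality of [T].  Thus [T = T(f)],
    and the parts of degree [T] express [M(f)] through the [M(g_i)]. *)
Require Import Defs.
From mathcomp Require Import all_boot all_order all_algebra.
From mathcomp Require Import mpoly.

Set Implicit Arguments.
Unset Strict Implicit.
Unset Printing Implicit Defensive.

Import GRing.Theory.
Local Open Scope ring_scope.

Lemma mnm_ind (n : nat) (Q : 'X_{1..n} -> Prop) :
  Q 0%MM -> (forall i t, Q t -> Q (U_(i) + t)%MM) -> forall t, Q t.
Proof.
move=> Q0 QS t; rewrite [t]multinomUE_id.
elim: (index_enum _) => [|i r IH]; first by rewrite big_nil.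
rewrite big_cons; elim: (t i) => [|k IHk]; first by rewrite mulm0n add0m.
by rewrite mulmS -addmA; apply: QS.
Qed.

Section Support.
Variables (R : idomainType) (n : nat).
Notation P := {mpoly R[n]}.
Implicit Types (Q : 'X_{1..n} -> Prop) (f h : P).

Definition supp_in Q f := forall t, t \in msupp f -> Q t.

Lemma supp_in0 Q : supp_in Q 0.
Proof. by move=> t; rewrite mcoeff_msupp mcoeff0 eqxx. Qed.

Lemma supp_inD Q f h : supp_in Q f -> supp_in Q h -> supp_in Q (f + h).
Proof.
by move=> Qf Qh t /msuppD_le; rewrite mem_cat => /orP[/Qf|/Qh].
Qed.

Lemma supp_inN Q f : supp_in Q f -> supp_in Q (- f).
Proof. by move=> Qf t; rewrite (perm_mem (msuppN f)) => /Qf. Qed.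

Lemma supp_inZ Q a f : supp_in Q f -> supp_in Q (a *: f).
Proof. by move=> Qf t /msuppZ_le /Qf. Qed.

Lemma supp_in_sum Q (I : eqType) (r : seq I) (F : I -> P) :
  (forall i, i \in r -> supp_in Q (F i)) -> supp_in Q (\sum_(i <- r) F i).
Proof.
move=> QF; rewrite big_seq; apply: (big_ind (supp_in Q)) => //.
  exact: supp_in0.
by move=> f h; apply: supp_inD.
Qed.

Lemma supp_inX Q a t : (a != 0 -> Q t) -> supp_in Q (a *: 'X_[t]).
Proof.
move=> Qt; case: (eqVneq a 0) => [->|a0].
  by rewrite scale0r; apply: supp_in0.
move=> s; rewrite msuppMCX // mem_seq1 => /eqP->; exact: Qt.
Qed.

Lemma supp_inW (Q Q' : 'X_{1..n} -> Prop) f :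
  (forall t, Q t -> Q' t) -> supp_in Q f -> supp_in Q' f.
Proof. by move=> QQ' Qf t /Qf /QQ'. Qed.

End Support.

Section OreProduct.
Variables (R : idomainType) (n : nat) (O : multivariate_ore R n).
Notation P := {mpoly R[n]}.
Notation "f ** h" := (ore_mul O f h) (at level 40, left associativity).
Implicit Types (f h : P) (t w : 'X_{1..n}).

Lemma omul0l f : 0 ** f = 0.
Proof. by apply: (addrI (0 ** f)); rewrite -ore_mulDl !addr0. Qed.

Lemma omul0r f : f ** 0 = 0.
Proof. by apply: (addrI (f ** 0)); rewrite -ore_mulDr !addr0. Qed.

Lemma omulNl f h : (- f) ** h = - (f ** h).
Proof. by apply: (addrI (f ** h)); rewrite -ore_mulDl !subrr omul0l. Qed.

Lemma omul_suml (I : Type) (r : seq I) (F : I -> P) h :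
  (\sum_(i <- r) F i) ** h = \sum_(i <- r) F i ** h.
Proof.
by apply: (big_morph (fun f => f ** h)) => [f f'|]; rewrite ?omul0l ?ore_mulDl.
Qed.

Lemma omul_sumr (I : Type) (r : seq I) (F : I -> P) f :
  f ** (\sum_(i <- r) F i) = \sum_(i <- r) f ** F i.
Proof. by apply: big_morph => [h h'|]; rewrite ?omul0r ?ore_mulDr. Qed.

Lemma omulZl a f h : (a *: f) ** h = a *: (f ** h).
Proof. by rewrite -!(ore_mulCl O) ore_mulA. Qed.

Lemma in_varsC k (a : R) : in_vars k (a%:MP : P).
Proof.
move=> t i; rewrite mcoeff_msupp mcoeffC; case: (eqVneq t 0%MM) => [-> _ _|_].
  by rewrite mnm0E.
by rewrite mulr0 eqxx.
Qed.

Lemma in_varsX k (i : 'I_n) : (i < k)%N -> in_vars k ('X_i : P).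
Proof.
move=> ik t j; rewrite msuppX mem_seq1 => /eqP-> kj; rewrite mnm1E.
by case: eqP => // ij; move: ik; rewrite ij ltnNge kj.
Qed.

Lemma omulXiC (i : 'I_n) (a : R) :
  'X_i ** a%:MP = ore_alpha O i a *: 'X_i + (ore_delta O i a)%:MP.
Proof.
rewrite (ore_mulC (ore_iterated O i)); last exact: in_varsC.
by rewrite ore_AlphaC ore_DeltaC ore_mulCl.
Qed.

Lemma omulXiXj (i j : 'I_n) : 'X_i ** 'X_j = 'X_j ** 'X_i.
Proof.
wlog ij : i j / (i < j)%N => [hw|].
  case: (ltngtP i j) => [ij|ji|/val_inj->//]; first exact: hw.
  by apply/esym/hw.
rewrite [RHS](ore_mulC (ore_iterated O j)); last exact: in_varsX.
by rewrite ore_AlphaX // ore_DeltaX // addr0.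
Qed.

Lemma omulXi_mulpow (i j : 'I_n) k f :
  'X_i ** (mulpow (ore_mul O) 'X_j k ** f)
  = mulpow (ore_mul O) 'X_j k ** ('X_i ** f).
Proof.
elim: k f => [|k IH] f; first by rewrite /= !ore_mul1.
rewrite /mulpow !iterS -/(mulpow _ _ _) -!ore_mulA -IH.
by rewrite !ore_mulA omulXiXj.
Qed.

Lemma omulXiX (i : 'I_n) t : 'X_i ** 'X_[t] = 'X_[U_(i) + t].
Proof.
rewrite -(ore_term O t) -(ore_term O (_ + t)%MM); have := mem_index_enum i.
have := index_enum_uniq 'I_n.
elim: (index_enum _) => // k r IH /= /andP[kr ur].
rewrite !big_cons inE => /predU1P[ik|ir].
  subst k; rewrite mnmDE mnm1E eqxx add1n /mulpow iterS -ore_mulA;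
    congr (_ ** (_ ** _)).
  rewrite !big_seq; apply: eq_bigr => j jr; rewrite mnmDE mnm1E.
  by case: eqP jr kr => // <- ->.
rewrite omulXi_mulpow IH // mnmDE mnm1E.
by case: eqP kr => // <-; rewrite ir.
Qed.

Lemma omulXX t w : 'X_[t] ** 'X_[w] = 'X_[t + w].
Proof.
elim/mnm_ind: t => [|i t IH]; first by rewrite add0m mpolyX0 ore_mul1.
by rewrite -omulXiX -ore_mulA IH omulXiX addmA.
Qed.

Lemma ore_alpha0 i : ore_alpha O i 0 = 0.
Proof.
have A0 : ore_Alpha O i 0%:MP = 0.
  have := ore_sigmaD (ore_iterated O i) (@in_varsC i 0) (@in_varsC i 0).
  rewrite -mpolyCD addr0 => /esym eA.
  by apply: (addrI (ore_Alpha O i 0%:MP)); rewrite addr0.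
by move: A0; rewrite ore_AlphaC => /mpolyP /(_ 0%MM);
  rewrite mcoeffC eqxx mulr1 mcoeff0.
Qed.

Lemma alpha_term0r t : alpha_term O t 0 = 0.
Proof.
rewrite /alpha_term; elim: (enum _) => //= i r ->.
by elim: (t i) => //= k ->; rewrite ore_alpha0.
Qed.

Lemma alpha_term0 a : alpha_term O 0 a = a.
Proof. by rewrite /alpha_term; elim: (enum _) => //= i r ->; rewrite mnm0E. Qed.

Lemma ore_alpha_iter i j k a :
  ore_alpha O i (iter k (ore_alpha O j) a) = iter k (ore_alpha O j) (ore_alpha
    O i a).
Proof. by elim: k => //= k <-; rewrite ore_alpha_alpha. Qed.

Lemma alpha_termS i t a :
  alpha_term O (U_(i) + t) a = ore_alpha O i (alpha_term O t a).
Proof.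
rewrite /alpha_term; have := mem_enum 'I_n i; rewrite inE.
have := enum_uniq 'I_n.
elim: (enum _) => // k r IH /= /andP[kr ur]; rewrite inE => /predU1P[ik|ir].
  subst k; rewrite mnmDE mnm1E eqxx add1n iterS;
    congr (ore_alpha O i (iter _ _ _)).
  elim: r {IH ur} kr => //= j r IH; rewrite inE negb_or => /andP[ij ir].
  by rewrite IH // mnmDE mnm1E (negPf ij).
rewrite IH // ore_alpha_iter mnmDE mnm1E.
by case: eqP kr => // <-; rewrite ir.
Qed.

Lemma gmul_monomr f b w :
  graded_mul O f (b *: 'X_[w])
  = \sum_(t <- msupp f) (f@_t * alpha_term O t b) *: 'X_[t + w].
Proof.
apply: eq_bigr => t _; have [->|b0] := eqVneq b 0.
  by rewrite scale0r msupp0 big_nil alpha_term0r mulr0 scale0r.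
by rewrite msuppMCX // big_seq1 mcoeffZ mcoeffX eqxx mulr1.
Qed.

Lemma gmul_monom a t b w :
  graded_mul O (a *: 'X_[t]) (b *: 'X_[w])
  = (a * alpha_term O t b) *: 'X_[t + w].
Proof.
rewrite gmul_monomr; have [->|a0] := eqVneq a 0.
  by rewrite scale0r msupp0 big_nil mul0r scale0r.
by rewrite msuppMCX // big_seq1 mcoeffZ mcoeffX eqxx mulr1.
Qed.

Lemma gmul1l f : graded_mul O 1 f = f.
Proof.
rewrite /graded_mul msupp1 big_seq1 [RHS]mpolyE; apply: eq_bigr => w _.
by rewrite mcoeff1 eqxx mul1r alpha_term0 add0m.
Qed.

Lemma gmul0r f : graded_mul O f 0 = 0.
Proof. by rewrite /graded_mul big1 // => t _; rewrite msupp0 big_nil. Qed.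

Section TermOrdering.
Variable prec : rel 'X_{1..n}.
Hypothesis prec_ord : term_ordering prec.

Lemma term_ordering_trans : transitive prec.
Proof. by case: prec_ord => -[]. Qed.

Lemma term_ordering_addl w s t : prec s t -> prec (w + s)%MM (w + t)%MM.
Proof. by case: prec_ord => _ +; apply. Qed.

Lemma term_ordering_gt0 t : t != 0%MM -> prec 0%MM t.
Proof.
case: prec_ord => -[_ _ tot wf] _ t0.
case/orP: (tot _ _ t0) => // lt_t0; exfalso.
suff: forall s, Acc prec s -> forall k, s = (t *+ k)%MM -> False.
  by move/(_ (t *+ 0)%MM (wf _) 0%N erefl).
move=> s; elim=> {}s _ IH k es; apply: (IH (t *+ k.+1)%MM _ _ erefl).
by rewrite es mulmSr -[X in prec _ X]addm0 term_ordering_addl.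
Qed.

Lemma term_ordering_ltU (i : 'I_n) t : prec t (U_(i) + t)%MM.
Proof.
rewrite addmC -{1}[t]addm0; apply: term_ordering_addl.
by apply: term_ordering_gt0; rewrite mnm1_eq0.
Qed.

Lemma omulXC t a : exists2 r,
  supp_in (fun s => prec s t) r &
  'X_[t] ** a%:MP = alpha_term O t a *: 'X_[t] + r.
Proof.
elim/mnm_ind: t => [|i t [r rt IH]].
  exists 0; first exact: supp_in0.
  by rewrite mpolyX0 ore_mul1 alpha_term0 addr0 alg_mpolyC.
have omulXiZX b s : 'X_i ** (b *: 'X_[s])
    = ore_alpha O i b *: 'X_[U_(i) + s] + ore_delta O i b *: 'X_[s].
  by rewrite -(ore_mulCl O b) ore_mulA omulXiC ore_mulDl omulZl omulXiX
    ore_mulCl.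
rewrite -omulXiX -ore_mulA IH ore_mulDr omulXiZX alpha_termS -addrA.
eexists; last by rewrite omulXiX.
apply: supp_inD; first by apply: supp_inX => _; apply: term_ordering_ltU.
rewrite [r]mpolyE omul_sumr; apply: supp_in_sum => s /rt st; rewrite omulXiZX.
apply: supp_inD; apply: supp_inX => _; first exact: term_ordering_addl.
exact: term_ordering_trans (term_ordering_ltU i t).
Qed.

Lemma omul_monom a t b w : exists2 r,
  supp_in (fun s => prec s (t + w)%MM) r &
  (a *: 'X_[t]) ** (b *: 'X_[w]) = (a * alpha_term O t b) *: 'X_[t + w] + r.
Proof.
have [r rt er] := omulXC t b; exists (a *: (r ** 'X_[w])).
  apply: supp_inZ; rewrite [r]mpolyE omul_suml; apply: supp_in_sum => s /rt st.
  rewrite omulZl omulXX; apply: supp_inX => _.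
  by rewrite ![(_ + w)%MM]addmC; apply: term_ordering_addl.
rewrite omulZl -(ore_mulCl O b) ore_mulA er ore_mulDl omulZl omulXX.
by rewrite scalerDr scalerA.
Qed.

Lemma omul_supp (Q : 'X_{1..n} -> Prop) f h :
  (forall t w s, t \in msupp f -> w \in msupp h ->
     (s == t + w)%MM || prec s (t + w)%MM -> Q s) ->
  supp_in Q (f ** h).
Proof.
move=> QS; rewrite [f]mpolyE [h]mpolyE omul_suml.
apply: supp_in_sum => t tf; rewrite omul_sumr; apply: supp_in_sum => w wh.
have [r rl ->] := omul_monom f@_t t h@_w w; apply: supp_inD.
  by apply: supp_inX => _; apply: (QS t w); rewrite ?eqxx.
by apply: supp_inW rl => s st; apply: (QS t w); rewrite ?st ?orbT.
Qed.

End TermOrdering.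
End OreProduct.

Section MaxTerm.
Variables (T : eqType) (lt : rel T).
Hypothesis lt_wo : well_order lt.

Lemma max_termP (s : seq T) t :
  max_term lt s = Some t <->
  t \in s /\ {in s, forall t', (t' == t) || lt t' t}.
Proof.
have [irr tr tot _] := lt_wo.
have maxP t' : t' \in [seq t <- s | all (fun t' => (t' == t) || lt t' t) s] <->
    t' \in s /\ {in s, forall t'', (t'' == t') || lt t'' t'}.
  rewrite mem_filter; split=> [/andP[/allP]|[? ?]] //.
  by apply/andP; split=> //; apply/allP.
split=> [e|[ts tmax]].
  by apply/maxP; move: e; rewrite /max_term; case: filter => //= ? ? [->];
    rewrite mem_head.
move: maxP; rewrite /max_term; case: filter => [|t' r] maxP.
  by have /maxP : t \in s /\ {in s, forall t', (t' == t) || lt t' t} by [].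
have /maxP[t's t'max] := mem_head t' r; congr Some.
case/predU1P: (tmax _ t's) => // lt1; case/predU1P: (t'max _ ts) => // lt2.
by have := irr t; rewrite (tr _ _ _ lt2 lt1).
Qed.

Lemma max_term_ex (s : seq T) :
  s != [::] -> exists t, t \in s /\ {in s, forall t', (t' == t) || lt t' t}.
Proof.
have [irr tr tot _] := lt_wo.
elim: s => // x [|y s] IH _.
  by exists x; split=> [|t']; rewrite ?mem_head // inE => ->.
have [//|t [ts tmax]] := IH.
have [xt|xt] := boolP ((x == t) || lt x t).
  exists t; rewrite in_cons ts orbT; split=> // t'.
  by rewrite in_cons => /predU1P[->|/tmax].
move: xt; rewrite negb_or => /andP[/tot /orP[->//|tx] _].
exists x; rewrite mem_head; split=> // t'.
rewrite in_cons => /predU1P[->|/tmax /predU1P[->|t't]];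
  rewrite ?eqxx ?tx ?orbT //.
by rewrite (tr _ _ _ t't tx) orbT.
Qed.

End MaxTerm.

Section ModuleSupport.
Variables (R : idomainType) (n m : nat).
Notation V := 'rV[{mpoly R[n]}]_m.
Implicit Types (Q : mterm n m -> Prop) (v w : V) (T : mterm n m).

Definition msupp_in Q v := forall i, supp_in (fun t => Q (t, i)) (v 0 i).

Lemma msupp_in0 Q : msupp_in Q 0.
Proof. by move=> i; rewrite mxE; apply: supp_in0. Qed.

Lemma msupp_inD Q v w : msupp_in Q v -> msupp_in Q w -> msupp_in Q (v + w).
Proof. by move=> Qv Qw i; rewrite mxE; apply: supp_inD. Qed.

Lemma msupp_inN Q v : msupp_in Q v -> msupp_in Q (- v).
Proof. by move=> Qv i; rewrite mxE; apply: supp_inN. Qed.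

Lemma msupp_in_sum Q (I : finType) (F : I -> V) :
  (forall i, msupp_in Q (F i)) -> msupp_in Q (\sum_i F i).
Proof.
move=> QF; apply: (big_ind (msupp_in Q)) => //; first exact: msupp_in0.
by move=> v w; apply: msupp_inD.
Qed.

Lemma msupp_inW (Q Q' : mterm n m -> Prop) v :
  (forall T, Q T -> Q' T) -> msupp_in Q v -> msupp_in Q' v.
Proof. by move=> QQ' Qv i; apply: supp_inW (Qv i) => t; apply: QQ'. Qed.

Definition mono (a : R) T : V := \row_k ((a *: 'X_[T.1]) *+ (k == T.2)).

Definition mcoef v T : R := (v 0 T.2)@_T.1.

Lemma mono0 T : mono 0 T = 0.
Proof. by apply/rowP=> k; rewrite !mxE scale0r mul0rn. Qed.

Lemma monoD a b T : mono (a + b) T = mono a T + mono b T.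
Proof. by apply/rowP=> k; rewrite !mxE scalerDl mulrnDl. Qed.

Lemma mono_sum (I : Type) (r : seq I) (a : I -> R) T :
  mono (\sum_(i <- r) a i) T = \sum_(i <- r) mono (a i) T.
Proof.
by apply: (big_morph (mono^~ T)) => [a1 a2|]; rewrite ?mono0 ?monoD.
Qed.

Lemma mcoef_mono a T : mcoef (mono a T) T = a.
Proof. by rewrite /mcoef mxE eqxx mcoeffZ mcoeffX eqxx mulr1. Qed.

Lemma mcoefB v w T : mcoef (v - w) T = mcoef v T - mcoef w T.
Proof. by rewrite /mcoef !mxE mcoeffB. Qed.

Lemma mcoef_out Q v T : msupp_in Q v -> ~ Q T -> mcoef v T = 0.
Proof.
case: T => t i Qv nQ; apply: memN_msupp_eq0; apply/negP=> /Qv; exact: nQ.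
Qed.

Lemma mem_mod_supp v T : (T \in mod_supp v) = (mcoef v T != 0).
Proof.
rewrite /mcoef -mcoeff_msupp; case: T => t i /=; apply/flattenP/idP => /=.
  by case=> s /mapP[k _ ->] /mapP[t' t'v [-> ->]].
move=> tv; exists [seq (t, i) | t <- msupp (v 0 i)]; last exact: map_f.
by apply: map_f; rewrite mem_enum.
Qed.

Lemma mod_supp_neq0 v : v != 0 -> mod_supp v != [::].
Proof.
apply: contra => /eqP v0; apply/eqP/rowP => i; apply/mpolyP=> t.
rewrite mxE mcoeff0; apply/eqP; rewrite -[_ == 0]negbK.
by rewrite -[_ != 0](mem_mod_supp v (t, i)) v0.
Qed.

Section Order.
Variable lt : rel (mterm n m).
Hypothesis lt_wo : well_order lt.

Definition lte S T := (S == T) || lt S T.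

Lemma lt_lte_trans S T U : lt S T -> lte T U -> lt S U.
Proof. by case: lt_wo => _ tr _ _ ST /predU1P[<- //|]; apply: tr. Qed.

Lemma lte_lt_trans S T U : lte S T -> lt T U -> lt S U.
Proof. by case: lt_wo => _ tr _ _ /predU1P[-> //|]; apply: tr. Qed.

Lemma lte_trans S T U : lte S T -> lte T U -> lte S U.
Proof.
by move=> /predU1P[-> //|ST] TU; rewrite /lte (lt_lte_trans ST TU) orbT.
Qed.

Lemma lead_termP v T :
  lead_term lt v = Some T <-> mcoef v T != 0 /\ msupp_in (lte^~ T) v.
Proof.
rewrite /lead_term (max_termP lt_wo) mem_mod_supp; split=> -[Tv Tmax];
  split=> //.
  by move=> i t; rewrite mcoeff_msupp -[_ != 0](mem_mod_supp v (t, i)) => /Tmax.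
by case=> t i; rewrite mem_mod_supp -mcoeff_msupp => /Tmax.
Qed.

Lemma lead_term_neq0 v : v != 0 -> exists T, lead_term lt v = Some T.
Proof.
move=> /mod_supp_neq0 /(max_term_ex lt_wo)[T TP]; exists T.
exact/(max_termP lt_wo).
Qed.

Lemma lead_mon_mono v T :
  lead_term lt v = Some T -> lead_mon lt v = mono (mcoef v T) T.
Proof. by move=> vT; rewrite /lead_mon /lead_coeff vT. Qed.

Lemma mcoef_lt v T : msupp_in (lt^~ T) v -> mcoef v T = 0.
Proof. by move=> /mcoef_out; apply; case: lt_wo => ->. Qed.

Lemma msupp_in_lt v T :
  msupp_in (lte^~ T) v -> mcoef v T = 0 -> msupp_in (lt^~ T) v.
Proof.
move=> vT c0 i t tv; case/predU1P: (vT i t tv) => // eT.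
have : mcoef v T != 0 by rewrite -eT /mcoef -mcoeff_msupp.
by rewrite c0 eqxx.
Qed.

Lemma msupp_in_mono (Q : mterm n m -> Prop) a T : Q T -> msupp_in Q (mono a T).
Proof.
move=> QT k; rewrite mxE; case: eqP => [->|_]; last exact: supp_in0.
by apply: supp_inX => _; case: T QT.
Qed.

Lemma msupp_in_sub_mono v T :
  msupp_in (lte^~ T) v -> msupp_in (lt^~ T) (v - mono (mcoef v T) T).
Proof.
move=> vT; apply: msupp_in_lt; last by rewrite mcoefB mcoef_mono subrr.
by apply: msupp_inD => //; apply: msupp_inN; apply: msupp_in_mono;
  rewrite /lte eqxx.
Qed.

End Order.
End ModuleSupport.

Section Representations.
Variables (R : idomainType) (n m u : nat) (O : multivariate_ore R n).
Variables (prec : rel 'X_{1..n}) (lt : rel (mterm n m)).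
Hypotheses (prec_ord : term_ordering prec) (lt_ord : compatible_ordering prec
  lt).
Notation P := {mpoly R[n]}.
Notation V := 'rV[P]_m.
Notation "f ** h" := (ore_mul O f h) (at level 40, left associativity).
Notation sc := (lscale (ore_mul O)).
Notation lte := (lte lt).
Implicit Types (f h p : P) (v w : V) (S T D : mterm n m).

Let lt_wo : well_order lt. Proof. by case: lt_ord. Qed.

Lemma mterm_mul_lt t S T : lt S T -> lt (mterm_mul t S) (mterm_mul t T).
Proof. by case: lt_ord => _ _; apply. Qed.

Lemma mterm_mul_lte t S T : lte S T -> lte (mterm_mul t S) (mterm_mul t T).
Proof.
by rewrite /lte => /predU1P[->|/mterm_mul_lt ->]; rewrite ?eqxx ?orbT.
Qed.

Lemma mterm_mul_prec s t T :
  (s == t) || prec s t -> lte (mterm_mul s T) (mterm_mul t T).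
Proof.
case: lt_ord => _ H _; rewrite /lte => /predU1P[->|/H ->];
  by rewrite ?eqxx ?orbT.
Qed.

Lemma mterm_mulA s t T : mterm_mul (s + t)%MM T = mterm_mul s (mterm_mul t T).
Proof. by rewrite /mterm_mul addmA. Qed.

Lemma scDr f v w : sc f (v + w) = sc f v + sc f w.
Proof. by apply/rowP=> i; rewrite !mxE ore_mulDr. Qed.

Lemma sc0r f : sc f 0 = 0 :> V.
Proof. by apply/rowP=> i; rewrite !mxE omul0r. Qed.

Lemma sc_sumr (I : Type) (r : seq I) (F : I -> V) f :
  sc f (\sum_(i <- r) F i) = \sum_(i <- r) sc f (F i).
Proof. by apply: big_morph => [v w|]; rewrite ?sc0r ?scDr. Qed.

Lemma sc0l v : sc 0 v = 0.
Proof. by apply/rowP=> i; rewrite !mxE omul0l. Qed.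

Lemma scDl f h v : sc (f + h) v = sc f v + sc h v.
Proof. by apply/rowP=> i; rewrite !mxE ore_mulDl. Qed.

Lemma scNl f v : sc (- f) v = - sc f v.
Proof. by apply/rowP=> i; rewrite !mxE omulNl. Qed.

Lemma scBl f h v : sc (f - h) v = sc f v - sc h v.
Proof. by rewrite scDl scNl. Qed.

Lemma sc_suml (I : Type) (r : seq I) (F : I -> P) v :
  sc (\sum_(i <- r) F i) v = \sum_(i <- r) sc (F i) v.
Proof. by apply: (big_morph (fun f => sc f v)) => [f h|];
  rewrite ?sc0l ?scDl. Qed.

Lemma scA f h v : sc (f ** h) v = sc f (sc h v).
Proof. by apply/rowP=> i; rewrite !mxE ore_mulA. Qed.

Lemma sc_supp (Q : mterm n m -> Prop) f v :
  (forall S T, lt S T -> Q T -> Q S) ->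
  (forall t i s, t \in msupp f -> s \in msupp (v 0 i) ->
     Q (mterm_mul t (s, i))) ->
  msupp_in Q (sc f v).
Proof.
move=> Qdown Qfv i; rewrite mxE.
apply: (omul_supp prec_ord) => t w s tf wv sP; have := Qfv t i w tf wv.
have := mterm_mul_prec (0%MM, i) sP; rewrite /mterm_mul /= !addm0.
by case/predU1P => [->|/Qdown].
Qed.

Lemma sc_monom_lead a t v T : msupp_in (lte^~ T) v ->
  msupp_in (lt^~ (mterm_mul t T))
    (sc (a *: 'X_[t]) v
     - mono (a * alpha_term O t (mcoef v T)) (mterm_mul t T)).
Proof.
move=> vT; have [_ tr _ _] := lt_wo.
rewrite -{1}(subrK (mono (mcoef v T) T) v) scDr -addrA; apply: msupp_inD.
  apply: sc_supp => [S S' SS' S'T|]; first exact: tr S'T.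
  move=> w i s /supp_inX -/(_ (eq^~ t) (fun _ => erefl)) -> sv.
  apply: mterm_mul_lt; exact: msupp_in_sub_mono sv.
move=> k; rewrite !mxE /=; case: eqP => [->|_].
  have [r rl ->] := omul_monom O prec_ord a t (mcoef v T) T.1.
  rewrite addrAC subrr add0r => s /rl st.
  have := mterm_mul_prec (0%MM, T.2) (_ : (s == t + T.1)%MM || prec s (t +
    T.1)%MM).
  rewrite st orbT => /(_ isT);
    rewrite /mterm_mul /= !addm0 => /predU1P[[es]|//].
  by case: prec_ord st => -[irr _ _ _] _; rewrite es irr.
by rewrite omul0r mulr0n subr0; apply: supp_in0.
Qed.

Lemma gscale_mono a t c T :
  lscale (graded_mul O) (a *: 'X_[t]) (mono c T)
  = mono (a * alpha_term O t c) (mterm_mul t T).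
Proof.
apply/rowP=> k; rewrite !mxE /=; case: eqP => _; first exact: gmul_monom.
exact: gmul0r.
Qed.

Variable g : 'I_u -> V.
Variable G : 'I_u -> mterm n m.
Hypothesis gG : forall i, lead_term lt (g i) = Some (G i).

Definition rep (Q : mterm n m -> Prop) v :=
  exists2 l : 'I_u -> P, v = \sum_i sc (l i) (g i)
    & forall i, supp_in (fun t => Q (mterm_mul t (G i))) (l i).

Lemma rep0 Q : rep Q 0.
Proof.
exists (fun=> 0) => [|i]; last exact: supp_in0.
by rewrite big1 // => i _; rewrite sc0l.
Qed.

Lemma repD Q v w : rep Q v -> rep Q w -> rep Q (v + w).
Proof.
move=> [l -> lQ] [l' -> l'Q]; exists (fun i => l i + l' i) => [|i].
  by rewrite -big_split; apply: eq_bigr => i _; rewrite scDl.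
exact: supp_inD.
Qed.

Lemma repN Q v : rep Q v -> rep Q (- v).
Proof.
move=> [l -> lQ]; exists (fun i => - l i) => [|i]; last exact: supp_inN.
by rewrite -sumrN; apply: eq_bigr => i _; rewrite scNl.
Qed.

Lemma rep_sum Q (I : finType) (F : I -> V) :
  (forall i, rep Q (F i)) -> rep Q (\sum_i F i).
Proof.
move=> QF; apply: (big_ind (rep Q)) => //; first exact: rep0.
by move=> v w; apply: repD.
Qed.

Lemma repW (Q Q' : mterm n m -> Prop) v :
  (forall T, Q T -> Q' T) -> rep Q v -> rep Q' v.
Proof.
move=> QQ' [l -> lQ]; exists l => // i; apply: supp_inW (lQ i) => t; exact: QQ'.
Qed.

Lemma sum_sc_delta f j : \sum_i sc (f *+ (i == j)) (g i) = sc f (g j).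
Proof.
rewrite (bigD1 j) //= eqxx big1 ?addr0 // => i /negPf ->.
by rewrite mulr0n sc0l.
Qed.

Lemma rep_sc Q f j :
  supp_in (fun t => Q (mterm_mul t (G j))) f -> rep Q (sc f (g j)).
Proof.
move=> fQ; exists (fun i => f *+ (i == j)) => [|i];
  first by rewrite sum_sc_delta.
by case: eqP => [->|_]; last exact: supp_in0.
Qed.

Lemma rep_shift D a t v : rep (lt^~ D) v ->
  rep (lt^~ (mterm_mul t D)) (sc (a *: 'X_[t]) v).
Proof.
move=> [l -> lD]; rewrite sc_sumr; apply: rep_sum => i; rewrite -scA.
apply: rep_sc; apply: (omul_supp prec_ord) => t' w s.
move=> /supp_inX -/(_ (eq^~ t) (fun _ => erefl)) -> /lD wD.
move=> /(mterm_mul_prec (G i)) H; apply: (lte_lt_trans lt_wo H).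
by rewrite mterm_mulA; apply: mterm_mul_lt.
Qed.

Lemma left_module_gen_rep v :
  left_module_gen O g v <-> rep (fun=> True) v.
Proof.
split=> [[s [h [b [bg ->]]]]|[l -> _]].
  by apply: rep_sum => k; have [j ->] := bg k; apply: rep_sc.
by exists u, l, g; split=> // i; exists i.
Qed.

Lemma rep_supp (Q : mterm n m -> Prop) v :
  (forall S T, lt S T -> Q T -> Q S) -> rep Q v -> msupp_in Q v.
Proof.
move=> Qdown [l -> lQ]; apply: msupp_in_sum => i.
apply: sc_supp => // t k s tl; have /(lead_termP lt_wo)[_ gi] := gG i.
move=> /gi /(mterm_mul_lte t) /predU1P[->|/Qdown]; last by apply; apply: lQ.
exact: lQ.
Qed.

Lemma rep_max (Q : mterm n m -> Prop) v : rep Q v -> v != 0 ->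
  exists2 T, Q T & rep (lte^~ T) v.
Proof.
move=> [l ev lQ] v0.
pose s := flatten [seq [seq mterm_mul t (G i) | t <- msupp (l i)] | i <- enum
  'I_u].
have sP i t : t \in msupp (l i) -> mterm_mul t (G i) \in s.
  move=> tl; apply/flattenP; exists [seq mterm_mul t (G i) | t <- msupp (l i)].
    by apply: map_f; rewrite mem_enum.
  exact: map_f.
have /(max_term_ex lt_wo)[T [Ts Tmax]] : s != [::].
  apply: contra v0 => /eqP s0; rewrite ev big1 // => i _.
  suff -> : l i = 0 by rewrite sc0l.
  apply/eqP; rewrite -msupp_eq0; apply/eqP.
  by case: msupp (sP i) => // t r /(_ t (mem_head _ _)); rewrite s0.
exists T.
  by have /flattenP[_ /mapP[i _ ->] /mapP[t tl ->]] := Ts; apply: lQ.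
by exists l => // i t tl; apply/Tmax/sP.
Qed.

Notation lc i := (mcoef (g i) (G i)).

Lemma sum_monom_lead (a : 'I_u -> R) (lam : 'I_u -> 'X_{1..n}) T :
  (forall i, a i != 0 -> mterm_mul (lam i) (G i) = T) ->
  msupp_in (lt^~ T)
    (\sum_i sc (a i *: 'X_[lam i]) (g i)
     - mono (\sum_i a i * alpha_term O (lam i) (lc i)) T).
Proof.
move=> aT; rewrite mono_sum -sumrB; apply: msupp_in_sum => i.
have [->|a0] := eqVneq (a i) 0.
  by rewrite scale0r sc0l mul0r mono0 subr0; apply: msupp_in0.
rewrite -(aT i a0); apply: sc_monom_lead.
by have /(lead_termP lt_wo)[] := gG i.
Qed.

Lemma s_L_monom (a : 'I_u -> R) (lam : 'I_u -> 'X_{1..n}) (h : 'rV[P]_u) T :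
  (forall i, h 0 i = a i *: 'X_[lam i]) ->
  (forall i, a i != 0 -> mterm_mul (lam i) (G i) = T) ->
  s_L O lt g h = mono (\sum_i a i * alpha_term O (lam i) (lc i)) T.
Proof.
move=> ha aT; rewrite mono_sum; apply: eq_bigr => i _.
rewrite ha (lead_mon_mono (gG i)) gscale_mono.
by have [->|/aT ->//] := eqVneq (a i) 0; rewrite mul0r !mono0.
Qed.

Definition top_term T i : 'X_{1..n} := (T.1 - (G i).1)%MM.

Definition top_coef T i f : R :=
  if mterm_mul (top_term T i) (G i) == T then f@_(top_term T i) else 0.

Lemma mterm_mul_top T i t : mterm_mul t (G i) = T -> t = top_term T i.
Proof. by move=> <-; rewrite /top_term /= addmK. Qed.

Lemma top_coef_neq0 T i f :
  top_coef T i f != 0 -> mterm_mul (top_term T i) (G i) = T.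
Proof. by rewrite /top_coef; case: ifP => [/eqP //|_]; rewrite eqxx. Qed.

Lemma top_coef_sum T i (I : Type) (r : seq I) (F : I -> P) :
  top_coef T i (\sum_(k <- r) F k) = \sum_(k <- r) top_coef T i (F k).
Proof.
apply: (big_morph (top_coef T i)) => [f h|]; rewrite /top_coef.
  by case: eqP; rewrite ?mcoeffD ?addr0.
by rewrite mcoeff0 if_same.
Qed.

Lemma top_coef_top T i a :
  (a != 0 -> mterm_mul (top_term T i) (G i) = T) ->
  top_coef T i (a *: 'X_[top_term T i]) = a.
Proof.
move=> aT; rewrite /top_coef mcoeffZ mcoeffX eqxx mulr1.
by case: eqP => // nT; have [//|/aT] := eqVneq a 0.
Qed.

Lemma sub_top_supp T i f : supp_in (fun t => lte (mterm_mul t (G i)) T) f ->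
  supp_in (fun t => lt (mterm_mul t (G i)) T)
    (f - top_coef T i f *: 'X_[top_term T i]).
Proof.
move=> fT t; rewrite mcoeff_msupp mcoeffB mcoeffZ mcoeffX.
case: (eqVneq (mterm_mul t (G i)) T) => [eT|nT].
  rewrite (mterm_mul_top eT) eqxx mulr1 /top_coef.
  by rewrite -(mterm_mul_top eT) eT eqxx subrr eqxx.
have -> : top_coef T i f * (top_term T i == t)%:R = 0.
  case: (eqVneq (top_term T i) t) => [et|_]; last by rewrite mulr0.
  by rewrite /top_coef et (negPf nT) mul0r.
by rewrite subr0 -mcoeff_msupp => /fT; rewrite /lte (negPf nT).
Qed.

(* The degree-[T] part of a combination of homogeneous syzygies only involves,
   in each multiplier [f], the monomial that shifts the syzygy to degree [T]. *)
Lemma homogeneous_lift (b : 'rV[P]_u) f T :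
  homogeneous lt g b -> s_L O lt g b = 0 ->
  let S := \sum_i sc (b 0 i) (g i) in
  (S != 0 -> exists2 T', lead_term lt S = Some T' & rep (lte^~ T') S) ->
  exists q : P,
    (forall i, top_coef T i (graded_mul O f (b 0 i)) *: 'X_[top_term T i]
               = graded_mul O q (b 0 i)) /\
    rep (lt^~ T) (\sum_i sc (graded_mul O q (b 0 i)) (g i)).
Proof.
move=> [a [w [ba aD]]] sb0 S repS.
have gmul0l h : graded_mul O 0 h = 0 by rewrite /graded_mul msupp0 big_nil.
case: (pickP (fun i => a i != 0)) => [i0 ai0|a0]; last first.
  exists 0; split=> [i|].
    have /negbFE/eqP ai := a0 i; rewrite ba ai scale0r gmul0r gmul0l.
    by rewrite /top_coef mcoeff0 if_same scale0r.
  by rewrite big1 => [|i _]; [apply: rep0|rewrite gmul0l sc0l].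
pose D := mterm_mul (w i0) (G i0).
have {}aD i : a i != 0 -> mterm_mul (w i) (G i) = D.
  by move=> ai; have := aD _ _ ai ai0;
    rewrite /oterm_mul !gG => /(congr1 (odflt D)).
have repSD : rep (lt^~ D) S.
  have [->|S0] := eqVneq S 0; first exact: rep0.
  have [T' ST' rS] := repS S0.
  have SD : msupp_in (lt^~ D) S.
    have := sum_monom_lead aD; rewrite -(s_L_monom ba aD) sb0 subr0.
    by under eq_bigr do rewrite -ba.
  have [T'S _] := (lead_termP lt_wo _ _).1 ST'.
  have T'D : lt T' D.
    by case: T' T'S {ST' rS} => t k; rewrite /mcoef -mcoeff_msupp => /SD.
  by apply: repW rS => U UT'; apply: (lte_lt_trans lt_wo UT').
pose lam := (T.1 - D.1)%MM.
have mulD t : mterm_mul t D = T -> t = lam by rewrite /lam => <-;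
  rewrite /= addmK.
exists (if mterm_mul lam D == T then f@_lam *: 'X_[lam] else 0).
split=> [i|].
  have [ai|ai] := eqVneq (a i) 0.
    by rewrite ba ai scale0r !gmul0r /top_coef mcoeff0 if_same scale0r.
  rewrite ba gmul_monomr top_coef_sum.
  have coefE t : top_coef T i ((f@_t * alpha_term O t (a i)) *: 'X_[t + w i])
      = if mterm_mul t D == T then f@_t * alpha_term O t (a i) else 0.
    rewrite /top_coef mcoeffZ mcoeffX -(aD i ai) -mterm_mulA.
    case: eqP => [eT|nT]; last first.
      by case: eqP => // eT; case: nT; rewrite -(mterm_mul_top eT).
    have -> : (t + w i == top_term T i)%MM
        = (mterm_mul (t + w i)%MM (G i) == T).
      apply/eqP/eqP => [->//|]; exact: mterm_mul_top.
    by case: eqP => _; rewrite ?mulr1 ?mulr0.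
  rewrite (eq_bigr _ (fun t _ => coefE t)).
  case: eqP => [eT|nT].
    rewrite gmul_monom.
    have -> : top_term T i = (lam + w i)%MM.
      by rewrite -(@mterm_mul_top T i (lam + w i)%MM) // mterm_mulA (aD i ai).
    congr (_ *: _); have [fl|fl] := boolP (lam \in msupp f).
      rewrite (bigD1_seq lam) ?msupp_uniq //= eT eqxx big1 ?addr0 // => t tl.
      by case: eqP => // /mulD tlam; rewrite tlam eqxx in tl.
    rewrite (memN_msupp_eq0 fl) mul0r big_seq big1 // => t tf.
    by case: eqP => // /mulD tlam; rewrite -tlam tf in fl.
  rewrite gmul0l big1 ?scale0r // => t _; case: eqP => // tT.
  by case: nT; rewrite -(mulD t tT).
case: eqP => [lamD|_]; last first.
  by rewrite big1 => [|i _]; [apply: rep0|rewrite gmul0l sc0l].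
set q := _ *: _.
rewrite -[X in rep _ X](subrK (sc q S)); apply: repD; last first.
  by rewrite -lamD; apply: rep_shift.
rewrite sc_sumr -sumrB; apply: rep_sum => i.
have [ai|ai] := eqVneq (a i) 0.
  by rewrite ba ai scale0r gmul0r sc0l sc0r subrr; apply: rep0.
rewrite -scA -scBl -opprB scNl; apply: repN; apply: rep_sc;
  rewrite ba /q gmul_monom.
have [r rl ->] := omul_monom O prec_ord f@_lam lam (a i) (w i).
rewrite addrAC subrr add0r; apply: supp_inW rl => s slw.
have := mterm_mul_prec (G i) (_ : (s == lam + w i)%MM || prec s (lam + w i)%MM).
rewrite slw orbT => /(_ isT); rewrite mterm_mulA (aD i ai) lamD.
case/predU1P => // sT; exfalso.
have es : s = (lam + w i)%MM.
  by rewrite (mterm_mul_top sT) -(@mterm_mul_top T i (lam + w i)%MM) //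
    mterm_mulA (aD i ai).
by case: prec_ord slw => -[irr _ _ _] _; rewrite es irr.
Qed.

Lemma lead_term_ring_neq0 h : h != 0 ->
  exists s, [/\ lead_term_ring prec h = Some s, s \in msupp h
    & {in msupp h, forall t, (t == s) || prec t s}].
Proof.
rewrite -msupp_eq0 => /(max_term_ex (proj1 prec_ord))[s [sh smax]].
by exists s; split=> //; apply/(max_termP (proj1 prec_ord)).
Qed.

Lemma has_left_groebner_reprP v : v != 0 ->
  has_left_groebner_repr O prec lt g v <->
  exists2 T, lead_term lt v = Some T & rep (lte^~ T) v.
Proof.
move=> v0; split.
  have [T vT] := lead_term_neq0 lt_wo v0.
  case=> l [ev lv]; exists T => //; exists l => // i t tl.
  have li0 : l i != 0 by apply: contraTneq tl => ->; rewrite msupp0.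
  move/(_ i li0): lv; rewrite gG vT.
  have [s [-> _ smax]] := lead_term_ring_neq0 li0.
  by apply: (lte_trans lt_wo); apply/mterm_mul_prec/smax.
case=> T vT [l ev lv]; exists l; split=> // i li0.
by have [s [-> sl _]] := lead_term_ring_neq0 li0; rewrite gG vT; apply: lv sl.
Qed.

Lemma has_left_groebner_repr0 : has_left_groebner_repr O prec lt g 0.
Proof.
exists (fun=> 0); split=> [|i]; last by rewrite eqxx.
by rewrite big1 // => i _; rewrite sc0l.
Qed.

Lemma groebner_rep : is_left_groebner_basis O lt g ->
  forall f : V, left_module_gen O g f -> f != 0 ->
    exists2 T, lead_term lt f = Some T & rep (lte^~ T) f.
Proof.
move=> GB f fM f0; have [T fT] := lead_term_neq0 lt_wo f0; exists T => //.
have [_ _ _ wf] := lt_wo.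
elim/(well_founded_ind wf): T f fM f0 fT => T IH f fM f0 fT.
have [s [a [lam [j [a0 lamT fE]]]]] := GB f fM f0.
have {}lamT k : mterm_mul (lam k) (G (j k)) = T.
  by move: (lamT k); rewrite gG fT => /(congr1 (odflt T)).
have [_ fle] := (lead_termP lt_wo _ _).1 fT.
pose p := \sum_k sc (a k *: 'X_[lam k]) (g (j k)).
have repp : rep (lte^~ T) p.
  apply: rep_sum => k; apply: rep_sc; apply: supp_inX => _.
  by rewrite lamT /lte eqxx.
have fpM : left_module_gen O g (f - p).
  apply/left_module_gen_rep/repD; first exact/left_module_gen_rep.
  by apply: repN; apply: repW repp.
have fp_lt : msupp_in (lt^~ T) (f - p).
  have pT : msupp_in (lt^~ T) (p - lead_mon lt f).
    rewrite fE -sumrB; apply: msupp_in_sum => k.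
    rewrite (lead_mon_mono (gG _)) gscale_mono -{1}(lamT k).
    by apply: sc_monom_lead; have [] := (lead_termP lt_wo _ _).1 (gG (j k)).
  have -> : f - p = (f - lead_mon lt f) - (p - lead_mon lt f).
    by rewrite opprB addrA subrK.
  apply: msupp_inD; last exact: msupp_inN.
  by rewrite (lead_mon_mono fT); apply: msupp_in_sub_mono.
rewrite -(subrK p f); apply: repD => //.
have [->|fp0] := eqVneq (f - p) 0; first exact: rep0.
have [T' fpT'] := lead_term_neq0 lt_wo fp0.
have T'T : lt T' T.
  have [T'fp _] := (lead_termP lt_wo _ _).1 fpT'.
  by case: T' T'fp {fpT'} => t k; rewrite /mcoef -mcoeff_msupp => /fp_lt.
by apply: repW (IH _ T'T _ fpM fp0 fpT') => S /(lte_lt_trans lt_wo)/(_ T'T);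
  rewrite /lte orbC => ->.
Qed.

Lemma top_split (f : V) T : rep (lte^~ T) f ->
  exists2 a : 'I_u -> R,
    forall i, a i != 0 -> mterm_mul (top_term T i) (G i) = T
    & rep (lt^~ T) (f - \sum_i sc (a i *: 'X_[top_term T i]) (g i)).
Proof.
move=> [l -> lT]; exists (fun i => top_coef T i (l i)) => [i|].
  exact: top_coef_neq0.
rewrite -sumrB; apply: rep_sum => i; rewrite -scBl; apply: rep_sc.
exact: sub_top_supp.
Qed.

Variable B : 'rV[P]_u -> Prop.
Hypothesis BGM : is_gebauer_moeller_set O lt g B.
Hypothesis Brep : forall b, B b ->
  let S := \sum_i sc (b 0 i) (g i) in
  S != 0 -> exists2 T, lead_term lt S = Some T & rep (lte^~ T) S.

Lemma syzygy_lift (a : 'I_u -> R) T :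
  (forall i, a i != 0 -> mterm_mul (top_term T i) (G i) = T) ->
  \sum_i a i * alpha_term O (top_term T i) (lc i) = 0 ->
  rep (lt^~ T) (\sum_i sc (a i *: 'X_[top_term T i]) (g i)).
Proof.
move=> aT suma0; have [Bhom Bspan] := BGM.
pose h : 'rV[P]_u := \row_i (a i *: 'X_[top_term T i]).
have hE i : h 0 i = a i *: 'X_[top_term T i] by rewrite mxE.
have /Bspan[s [p [b [bB eh]]]] : s_L O lt g h = 0.
  by rewrite (s_L_monom hE aT) suma0 mono0.
have sb0 k : s_L O lt g (b k) = 0.
  apply/Bspan; exists 1%N, (fun=> 1), (fun=> b k); split=> //.
  by rewrite big_ord1; apply/rowP=> i; rewrite mxE gmul1l.
have /fin_all_exists[q qP] k := homogeneous_lift (p k) T (Bhom _ (bB k)) (sb0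
  k) (Brep (bB k)).
have aE i : a i *: 'X_[top_term T i] = \sum_k graded_mul O (q k) (b k 0 i).
  rewrite -{1}(top_coef_top (aT i)) -hE eh summxE top_coef_sum scaler_suml.
  by apply: eq_bigr => k _; have [<- _] := qP k; rewrite mxE.
under eq_bigr do rewrite aE sc_suml.
by rewrite exchange_big; apply: rep_sum => k; case: (qP k).
Qed.

Lemma gebauer_moeller_groebner : is_left_groebner_basis O lt g.
Proof.
move=> f /left_module_gen_rep fM f0.
have [T _ fT] := rep_max fM f0.
have [_ _ _ wf] := lt_wo.
elim/(well_founded_ind wf): T fT => T IH fT.
have [a aT frest] := top_split fT.
pose c := \sum_i a i * alpha_term O (top_term T i) (lc i).
have lt_down S S' : lt S S' -> lt S' T -> lt S T.
  by case: lt_wo => _ tr _ _; apply: tr.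
have [c0|c0] := eqVneq c 0.
  have : rep (lt^~ T) f.
    by rewrite -(subrK (\sum_i sc (a i *: 'X_[top_term T i]) (g i)) f);
      apply/repD/syzygy_lift.
  by move=> /rep_max /(_ f0)[T' T'T fT']; apply: IH fT'.
have fcT : msupp_in (lt^~ T) (f - mono c T).
  rewrite -(subrK (\sum_i sc (a i *: 'X_[top_term T i]) (g i)) f) -addrA.
  apply: msupp_inD; first exact: rep_supp frest.
  exact: sum_monom_lead.
have fTc : mcoef f T = c.
  by apply/eqP;
    rewrite -subr_eq0 -{1}(mcoef_mono c T) -mcoefB (mcoef_lt lt_wo fcT).
have leadf : lead_term lt f = Some T.
  apply/(lead_termP lt_wo); rewrite fTc; split=> //.
  rewrite -(subrK (mono c T) f); apply: msupp_inD.
    by apply: msupp_inW fcT => S; rewrite /lte orbC => ->.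
  by apply: msupp_in_mono; rewrite /lte eqxx.
pose A := [set i | a i != 0].
exists #|A|, (fun k => a (enum_val k)), (fun k => top_term T (enum_val k)),
  enum_val.
have aA (k : 'I_#|A|) : a (enum_val k) != 0 by have := enum_valP k; rewrite inE.
split=> // [k|]; first by rewrite leadf gG; congr Some; apply: aT.
rewrite (lead_mon_mono leadf) fTc mono_sum.
rewrite -(big_enum_val (fun i => lscale (graded_mul O) (a i *: 'X_[top_term T
  i]) (lead_mon lt (g i)))).
rewrite [LHS](bigID (mem A)) /= addrC big1 ?add0r => [|i]; last first.
  by rewrite inE negbK => /eqP->; rewrite mul0r mono0.
apply: eq_bigr => i; rewrite inE => ai.
by rewrite (lead_mon_mono (gG i)) gscale_mono aT.
Qed.

End Representations.

Section SPolynomials.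
Variables (R : idomainType) (n m u : nat) (O : multivariate_ore R n).
Variables (prec : rel 'X_{1..n}) (lt : rel (mterm n m)).
Variables (g : 'I_u -> 'rV[{mpoly R[n]}]_m) (c : 'I_u -> 'I_u -> R).

Lemma S_poly_syz i j : S_poly O lt g c i j
  = \sum_k lscale (ore_mul O) (b_syz O lt g c i j 0 k) (g k).
Proof.
under eq_bigr do rewrite mxE scBl.
by rewrite sumrB !sum_sc_delta.
Qed.

Lemma S_poly_in_module i j : left_module_gen O g (S_poly O lt g c i j).
Proof.
by exists u, (b_syz O lt g c i j 0), g; split; [move=> k;
  exists k|exact: S_poly_syz].
Qed.

End SPolynomials.

Theorem corollary61 (R : idomainType) (RPID : principal_ideal_ring R)
    (RZ : left_zacharias R) (n m u : nat) (O : multivariate_ore R n)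
    (alpha_aut : forall i : 'I_n, bijective (ore_alpha O i))
    (prec : rel 'X_{1..n}) (lt : rel (mterm n m))
    (prec_ord : term_ordering prec) (lt_ord : compatible_ordering prec lt)
    (g : 'I_u -> 'rV[{mpoly R[n]}]_m) (g_neq0 : forall i, g i != 0)
    (c : 'I_u -> 'I_u -> R) (c_lcm : is_lcm_choice O lt g c)
    (GM : {set 'I_u * 'I_u}) (GM_useful : is_useful_spair_set O lt g c GM) :
  is_left_groebner_basis O lt g <->
  forall i j : 'I_u, (i, j) \in GM ->
    has_left_groebner_repr O prec lt g (S_poly O lt g c i j).
Proof.
have lt_wo : well_order lt by case: lt_ord.
have /fin_all_exists[G gG] i := lead_term_neq0 lt_wo (g_neq0 i).
split=> [GB i j _|Srep].
  have [->|S0] := eqVneq (S_poly O lt g c i j) 0.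
    exact: has_left_groebner_repr0.
  apply/(has_left_groebner_reprP O prec_ord lt_ord gG S0).
  apply: (groebner_rep prec_ord lt_ord gG GB) => //; exact: S_poly_in_module.
have [_ BGM] := GM_useful.
apply: (gebauer_moeller_groebner prec_ord lt_ord gG BGM) => _ [[i j] ijGM ->]
  /=.
rewrite -S_poly_syz => S0.
by apply/(has_left_groebner_reprP O prec_ord lt_ord gG S0)/Srep.
Qed.
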